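(* Let $\pi$ be an affine bundle with $n$-dimensional fibres over an $m$-dimensional oriented affine real manifold $M^m$ with volume element $\mathrm{dvol}(\cdot)$. Let $\boldsymbol{\mathcal{P}}=\tfrac12\int \xi_\alpha P^{\alpha\beta}_\lambda(\boldsymbol{x})\,\xi_{\beta,\lambda}\cdot\mathrm{dvol}(\boldsymbol{x})$ be a variational Poisson bi-vector whose coefficients $P^{\alpha\beta}_\lambda(\boldsymbol{x})$ do not depend on the jet fibre variables $u^i_\sigma$. Let $\star$ be the variational Moyal product associated with $\boldsymbol{\mathcal{P}}$ (defined in the context). Then $\star$ is associative: for any three integral functionals $F=\int f(\boldsymbol{x}_1,[\boldsymbol{u}])\,\mathrm{dvol}(\boldsymbol{x}_1)$, $G=\int g(\boldsymbol{x}_2,[\boldsymbol{u}])\,\mathrm{dvol}(\boldsymbol{x}_2)$, $H=\int h(\boldsymbol{x}_3,[\boldsymbol{u}])\,\mathrm{dvol}(\boldsymbol{x}_3)$, the associator $$(F\star G)\star H-F\star(G\star H)$$ is an integral functional whose density is identically zero (at every order in $\hbar$) at all points of the infinite jet space $J^\infty(\pi)$ over $M^m$.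
   Context: **Jets and functionals.** $\boldsymbol{u}=(u^1,\dots,u^n)$ are fibre coordinates of $\pi$ and $u^i_\sigma$ (with $\sigma$ a multi-index) are the corresponding coordinates on the infinite jet space $J^\infty(\pi)$. The notation $f(\boldsymbol{x},[\boldsymbol{u}])$ means that $f$ is smooth and depends on $\boldsymbol{x}$ and on finitely many $u^i_\sigma$. $(\mathrm{d}/\mathrm{d}\boldsymbol{x})^\sigma$ denotes the total derivative, and $(-\mathrm{d}/\mathrm{d}\boldsymbol{x})^\sigma=(-1)^{|\sigma|}(\mathrm{d}/\mathrm{d}\boldsymbol{x})^\sigma$. An integral functional $F=\int f(\boldsymbol{x},[\boldsymbol{u}])\,\mathrm{dvol}(\boldsymbol{x})$ takes a section $\boldsymbol{s}$ of $\pi$ to $\int_{M^m}f(\boldsymbol{x},j^\infty_{\boldsymbol{x}}(\boldsymbol{s}))\,\mathrm{dvol}(\boldsymbol{x})$. Either $M^m$ is closed or the admissible sections decay fast enough near the boundary, so that no boundary terms occur. Summation over all repeated indices and multi-indices is understood. **Variational Poisson bi-vector.** The $\xi_{i,\sigma}$ are $\mathbb{Z}_2$-parity-odd (anticommuting) variables, namely the jet coordinates of the odd canonical conjugates $\xi_i$ of $u^i$. The differential operator $\|P^{\alpha\beta}_\lambda(\boldsymbol{x})(\mathrm{d}/\mathrm{d}\boldsymbol{x})^\lambda\|$ is skew-adjoint, and the bi-vector is Poisson, that is, its variational Schouten bracket with itself vanishes in horizontal cohomology. **Wedge coefficients.** Put $$c^{ij}_{\tau\zeta}(\boldsymbol{x})=\frac{\overrightarrow{\partial}}{\partial\xi_{i,\tau}}\Bigl(\tfrac12\xi_\alpha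 P^{\alpha\beta}_\lambda(\boldsymbol{x})\xi_{\beta,\lambda}\Bigr)\frac{\overleftarrow{\partial}}{\partial\xi_{j,\zeta}}=\tfrac12\bigl(\delta_{\tau,\varnothing}P^{ij}_\zeta(\boldsymbol{x})-\delta_{\zeta,\varnothing}P^{ji}_\tau(\boldsymbol{x})\bigr).$$ **Variational Moyal product.** With $f$ referred to a copy $(\boldsymbol{x}_1,[\boldsymbol{u}])$ and $g$ to a second identical copy $(\boldsymbol{x}_2,[\boldsymbol{v}])$ of $J^\infty(\pi)$, one sets $$F\star G=\int\Biggl(f|_{(\boldsymbol{x}_1,[\boldsymbol{u}])}\exp\biggl(\frac{\overleftarrow{\partial}}{\partial u^i_\sigma}\Bigl\lceil\Bigl(-\frac{\overleftarrow{\mathrm d}}{\mathrm d\boldsymbol{x}_1}\Bigr)^{\sigma}\Bigl(\frac{\overleftarrow{\mathrm d}}{\mathrm d\boldsymbol{x}_1}\Bigr)^{\tau}\Bigr\rceil\cdot\hbar\,c^{ij}_{\tau\zeta}(\boldsymbol{x})\cdot\Bigl\lceil\Bigl(\frac{\overrightarrow{\mathrm d}}{\mathrm d\boldsymbol{x}_2}\Bigr)^{\zeta}\Bigl(-\frac{\overrightarrow{\mathrm d}}{\mathrm d\boldsymbol{x}_2}\Bigr)^{\chi}\Bigr\rceil\frac{\overrightarrow{\partial}}{\partial v^j_\chi}\biggr)g|_{(\boldsymbol{x}_2,[\boldsymbol{v}])}\Biggr)\Biggr|_{\boldsymbol{x}_1=\boldsymbol{x}=\boldsymbol{x}_2,\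 [\boldsymbol{u}]=[\boldsymbol{v}]}\mathrm{dvol}(\boldsymbol{x}),$$ a formal power series in $\hbar$. Each power of the exponent introduces new summation indices. The symbols $\lceil\ldots\rceil$ indicate delay: in every term of the expansion, all partial derivatives with respect to jet variables act on a density first, and only afterwards do all the total derivatives in $\lceil\ldots\rceil$ act on that density. For example, two wedges contribute to the factor from $f$ the expression $\bigl(-\tfrac{\mathrm d}{\mathrm d\boldsymbol{x}_1}\bigr)^{\sigma_1\cup\sigma_2}\bigl(\tfrac{\mathrm d}{\mathrm d\boldsymbol{x}_1}\bigr)^{\tau_1\cup\tau_2}\tfrac{\partial^2 f}{\partial u^{i_1}_{\sigma_1}\partial u^{i_2}_{\sigma_2}}$. **Iterated products.** In $(F\star G)\star H$ and $F\star(G\star H)$ the densities $f,g,h$ are kept on separate copies of $J^\infty(\pi)$, and all copies are identified only at the end. A partial derivative $\partial/\partial u^i_\sigma$ of the outer product that falls on the inner product (whose coefficients $c^{ij}_{\tau\zeta}(\boldsymbol{x})$ do not depend on jet variables) acts by the Leibniz rule on the two densities in the inner product. The total derivatives accompanying that partial derivative act on the same density (the same graph vertex, over its own copy of $M^m$) on which the partial derivative has acted. The total derivatives of the inner product are delayed until all partial derivatives of both the inner and the outer products have acted on $f$, $g$, $h$. *)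

(* Defs.v *)
From HB Require Import structures.
From mathcomp Require Import all_boot all_order all_algebra finmap.
From mathcomp Require Import all_classical all_reals all_analysis.
Import Order.TTheory GRing.Theory Num.Theory.
Import numFieldNormedType.Exports.

Set Implicit Arguments.
Unset Strict Implicit.
Unset Printing Implicit Defensive.

Local Open Scope classical_set_scope.
Local Open Scope ring_scope.

(** * Multi-indices and functions of base coordinates *)

(* The empty multi-index is 0 and the union of multi-indices is +. *)
Definition multi (m : nat) := {ffun 'I_m -> nat}.

Definition mone m (k : 'I_m) : multi m := [ffun j => nat_of_bool (j == k)].

Definition mlen m (s : multi m) : nat := (\sum_(k < m) s k)%N.

(* D^s for a family of derivations (D k)_k. *)
Definition mder m (X : Type) (D : 'I_m -> X -> X) (s : multi m) (f : X) : X :=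
  foldr (fun k g => iter (s k) (D k) g) f (enum 'I_m).

Definition base_slice (R : realType) m (k : 'I_m) (g : 'rV[R]_m -> R)
  (y : 'rV[R]_m) : R -> R := fun t => g (y + t *: delta_mx ord0 k).

Definition base_partial (R : realType) m (k : 'I_m) (g : 'rV[R]_m -> R) :
  'rV[R]_m -> R := fun y => derive1 (base_slice k g y) 0.

(* C^oo on an open set V: all iterated partial derivatives exist and are
   continuous. *)
Definition smooth_base (R : realType) m (V : set 'rV[R]_m)
    (g : 'rV[R]_m -> R) : Prop :=
  forall ks : seq 'I_m, let h := foldr (@base_partial R m) g ks in
  forall y, V y ->
    {for y, continuous h} /\ forall k, derivable (base_slice k h y) 0 1.

(* Iterated Lebesgue integral over R^m; only applied to continuous functions
   with compact support. *)
Fixpoint iter_int (R : realType) m : ('rV[R]_m -> R) -> R :=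
  match m return ('rV[R]_m -> R) -> R with
  | 0 => fun g => g 0
  | m'.+1 => fun g => (\int[@lebesgue_measure R]_t
      iter_int (fun y : 'rV[R]_m' => g (row_mx (t%:M : 'rV[R]_1) y)))%R
  end.

(** * Oriented affine manifolds with a volume element *)

(* [chart] indexes an oriented affine atlas; [cpoint c] is the inverse of the
   coordinate map [ccoord c] on the open set [cimg c].  In the chart [c] the
   volume element is [vol c y] dy^1 ... dy^m, and [volume] is the Borel measure
   it defines. *)
Record affine_manifold (R : realType) (m : nat) := AffineManifold {
  space :> ptopologicalType;
  space_hausdorff : hausdorff_space space;
  space_second_countable : @second_countable space;
  chart : Type;
  cdom : chart -> set space;
  cimg : chart -> set 'rV[R]_m;
  ccoord : chart -> space -> 'rV[R]_m;
  cpoint : chart -> 'rV[R]_m -> space;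
  cdom_open : forall c, open (cdom c);
  cimg_open : forall c, open (cimg c);
  ccoord_cont : forall c, {within cdom c, continuous (ccoord c)};
  cpoint_cont : forall c, {within cimg c, continuous (cpoint c)};
  ccoordP : forall c x, cdom c x -> cimg c (ccoord c x);
  cpointP : forall c y, cimg c y -> cdom c (cpoint c y);
  ccoordK : forall c x, cdom c x -> cpoint c (ccoord c x) = x;
  cpointK : forall c y, cimg c y -> ccoord c (cpoint c y) = y;
  chart_cover : forall x, exists c, cdom c x;
  vol : chart -> 'rV[R]_m -> R;
  vol_smooth : forall c, smooth_base (cimg c) (vol c);
  vol_gt0 : forall c y, cimg c y -> 0 < vol c y;
  chart_change : forall c c' x, cdom c x -> cdom c' x ->
    exists A : 'M[R]_m, exists b : 'rV[R]_m, 0 < \det A /\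
      \forall x' \near x, ccoord c' x' = ccoord c x' *m A + b /\
        vol c (ccoord c x') = \det A * vol c' (ccoord c' x');
  volume : {measure set (g_sigma_algebraType (@open space)) -> \bar R};
  volumeE : forall c (g : 'rV[R]_m -> R) (K : set 'rV[R]_m),
    continuous g -> compact K -> K `<=` cimg c ->
    (forall y, ~ K y -> g y = 0) ->
    (\int[volume]_(x in cdom c) (g (ccoord c x))%:E)%E =
    (iter_int (fun y => g y * vol c y))%:E
}.

(** * Affine bundles, sections and their jets *)

(* [triv] indexes systems of adapted coordinates: base coordinates from
   [tchart t], and fibre coordinates [fib t] over the open set [tdom t]. *)
Record affine_bundle (R : realType) (m : nat) (M : affine_manifold R m)
    (n : nat) := AffineBundle {
  total : topologicalType;
  proj : total -> M;
  proj_cont : continuous proj;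
  triv : Type;
  tchart : triv -> chart M;
  tdom : triv -> set M;
  fib : triv -> total -> 'rV[R]_n;
  fpoint : triv -> M -> 'rV[R]_n -> total;
  tdom_open : forall t, open (tdom t);
  tdom_sub : forall t, tdom t `<=` cdom (tchart t);
  fib_cont : forall t, {within proj @^-1` tdom t, continuous (fib t)};
  fpoint_cont : forall t, {within tdom t `*` setT,
    continuous (fun p : M * 'rV[R]_n => fpoint t p.1 p.2)};
  proj_fpoint : forall t x v, tdom t x -> proj (fpoint t x v) = x;
  fib_fpoint : forall t x v, tdom t x -> fib t (fpoint t x v) = v;
  fpoint_fib : forall t e, tdom t (proj e) -> fpoint t (proj e) (fib t e) = e;
  triv_at : M -> triv;
  triv_atP : forall x, tdom (triv_at x) x;
  triv_change : forall t t', exists A : 'rV[R]_m -> 'M[R]_n,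
    exists b : 'rV[R]_m -> 'rV[R]_n,
    let V := ccoord (tchart t) @` (tdom t `&` tdom t') in
    [/\ forall i j, smooth_base V (fun y => A y i j),
        forall j, smooth_base V (fun y => b y ord0 j),
        forall y, V y -> A y \in unitmx &
        forall e, tdom t (proj e) -> tdom t' (proj e) ->
          let y := ccoord (tchart t) (proj e) in
          fib t' e = fib t e *m A y + b y]
}.

Section JetCalculus.
Variables (R : realType) (m n : nat).

(* The pair (i, s) stands for the index of the jet coordinate u^i_s. *)
Definition jidx := ('I_n * multi m)%type.

Definition jbump (a : jidx) (k : 'I_m) : jidx := (a.1, a.2 + mone k).

Definition jetfun := 'rV[R]_m -> (jidx -> R) -> R.

Definition jet_slice (c : 'I_m + jidx) (f : jetfun) (y : 'rV[R]_m)
    (u : jidx -> R) : R -> R :=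
  match c with
  | inl k => fun t => f (y + t *: delta_mx ord0 k) u
  | inr a => fun t => f y (fun b => u b + t * (b == a)%:R)
  end.

Definition jet_partial (c : 'I_m + jidx) (f : jetfun) : jetfun :=
  fun y u => derive1 (jet_slice c f y u) 0.

Definition dx (k : 'I_m) := jet_partial (inl k).
Definition du (a : jidx) := jet_partial (inr a).

(* Functions f(x,[u]) on V x R^oo; continuity is for the product topology. *)
Definition smooth_jet (V : set 'rV[R]_m) (f : jetfun) : Prop :=
  (exists S : {fset jidx}, forall y u u', V y ->
     (forall a, a \in S -> u a = u' a) -> f y u = f y u') /\
  forall cs : seq ('I_m + jidx)%type, let h := foldr jet_partial f cs in
  forall y (u : jidx -> R), V y ->
    {for (y, u), continuous
       (fun p : 'rV[R]_m * {ptws jidx -> R} => h p.1 p.2)} /\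
    forall c, derivable (jet_slice c h y u) 0 1.

Definition tD (k : 'I_m) (f : jetfun) : jetfun := fun y u =>
  dx k f y u + \sum_(a \in [set: jidx]) u (jbump a k) * du a f y u.

Definition tDm (s : multi m) (f : jetfun) : jetfun := mder tD s f.

Definition tDneg (s : multi m) (f : jetfun) : jetfun :=
  fun y u => (-1) ^+ mlen s * tDm s f y u.

(** * Superfunctions of the odd variables xi_{i,s} *)

(* [w C] is the coefficient of the product of the xi_a, a in C, taken in
   increasing order of their codes [choice.pickle a]. *)
Definition sfun := {fset jidx} -> jetfun.

(* Number of transpositions which sort the product xi_A xi_B. *)
Definition inversions (A B : {fset jidx}) : nat :=
  (\sum_(a <- A) \sum_(b <- B) (choice.pickle b < choice.pickle a))%N.

Definition xi (a : jidx) : sfun := fun C _ _ => (C == [fset a]%fset)%:R.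

Definition smul (w v : sfun) : sfun := fun C y u =>
  \sum_(A <- fpowerset C)
    (-1) ^+ inversions A (C `\` A)%fset * w A y u * v (C `\` A)%fset y u.

(* Left and right derivatives with respect to xi_a. *)
Definition dxi_l (a : jidx) (w : sfun) : sfun := fun C y u =>
  if a \in C then 0
  else (-1) ^+ inversions [fset a]%fset C * w (a |` C)%fset y u.

Definition dxi_r (a : jidx) (w : sfun) : sfun := fun C y u =>
  if a \in C then 0
  else (-1) ^+ inversions C [fset a]%fset * w (a |` C)%fset y u.

Definition stD (k : 'I_m) (w : sfun) : sfun := fun C y u =>
  tD k (w C) y u +
  \sum_(a \in [set: jidx]) smul (xi (jbump a k)) (dxi_l a w) C y u.

(* Sum over s of (-d/dx)^s (d_s w), transposed with respect to rho dx. *)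
Definition euler (rho : 'rV[R]_m -> R) (d : multi m -> sfun -> sfun)
    (w : sfun) : sfun := fun C y u =>
  (rho y)^-1 * \sum_(s \in [set: multi m]) (-1) ^+ mlen s *
    mder stD s (fun C y u => rho y * d s w C y u) C y u.

Definition var_u rho (i : 'I_n) : sfun -> sfun :=
  euler rho (fun s w C => du (i, s) (w C)).
Definition var_xi_l rho (i : 'I_n) : sfun -> sfun :=
  euler rho (fun s => dxi_l (i, s)).
Definition var_xi_r rho (i : 'I_n) : sfun -> sfun :=
  euler rho (fun s => dxi_r (i, s)).

Definition schouten rho (w v : sfun) : sfun := fun C y u =>
  \sum_(i < n) (smul (var_u rho i w) (var_xi_l rho i v) C y u
                - smul (var_xi_r rho i w) (var_u rho i v) C y u).

Definition sfun_ok (V : set 'rV[R]_m) (w : sfun) : Prop :=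
  (exists S : {fset jidx}, forall C y u, V y -> w C y u != 0 ->
     (C `<=` S)%fset) /\
  forall C, smooth_jet V (w C).

(* w rho dx is a horizontal differential. *)
Definition horizontally_exact (V : set 'rV[R]_m) rho (w : sfun) : Prop :=
  exists eta : 'I_m -> sfun, (forall k, sfun_ok V (eta k)) /\
    forall C y u, V y ->
      rho y * w C y u = \sum_(k < m) stD k (eta k) C y u.

(** * Bi-vectors in local coordinates *)

(* [P a b l] is the coefficient P^{ab}_l(x). *)
Definition coefs := 'I_n -> 'I_n -> multi m -> 'rV[R]_m -> R.

Definition diffop (P : coefs) (psi : 'I_n -> jetfun) (a : 'I_n) : jetfun :=
  fun y u => \sum_(b < n) \sum_(l \in [set: multi m])
    P a b l y * tDm l (psi b) y u.

(* Adjoint with respect to the pairing by integration against rho dx. *)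
Definition diffop_adj rho (P : coefs) (psi : 'I_n -> jetfun) (a : 'I_n) :
    jetfun :=
  fun y u => (rho y)^-1 * \sum_(b < n) \sum_(l \in [set: multi m])
    tDneg l (fun y u => rho y * P b a l y * psi b y u) y u.

Definition skew_adjoint (V : set 'rV[R]_m) rho (P : coefs) : Prop :=
  forall psi : 'I_n -> jetfun, (forall b, smooth_jet V (psi b)) ->
  forall a y u, V y -> diffop_adj rho P psi a y u = - diffop P psi a y u.

(* The density (1/2) xi_a P^{ab}_l xi_{b,l}. *)
Definition bivector_density (P : coefs) : sfun := fun C y u =>
  2^-1 * \sum_(a < n) \sum_(b < n) \sum_(l \in [set: multi m])
    P a b l y * smul (xi (a, 0)) (xi (b, l)) C y u.

(** * The variational Moyal product in local coordinates *)

(* c^{ij}_{t z} *)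
Definition wedge_coef (P : coefs) (i j : 'I_n) (t z : multi m)
    (y : 'rV[R]_m) : R :=
  2^-1 * ((t == 0)%:R * P i j z y - (z == 0)%:R * P j i t y).

(* A leg ((i, s), t) of a wedge, landing on a density, makes the partial
   derivative d/du^i_s and the delayed (-d/dx)^s (d/dx)^t act on it. *)
Definition leg := (jidx * multi m)%type.
Definition wedge := (leg * leg)%type.

Definition vertex (f : jetfun) (L : seq leg) : jetfun :=
  tDneg (\sum_(l <- L) l.1.2)
    (tDm (\sum_(l <- L) l.2) (foldr (fun l g => du l.1 g) f L)).

(* A (possibly iterated) product whose total derivatives are still delayed:
   [A L k] is the coefficient of hbar^k after the legs L of outer products have
   landed on A and all copies of the jet space have been identified.  The
   density itself is [A [::] k]. *)
Definition delayed := seq leg -> nat -> jetfun.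

Definition leaf (f : jetfun) : delayed :=
  fun L k y u => if k is 0 then vertex f L y u else 0.

(* The k-th power of the wedge operator comes with 1/k! and k independent sets
   of summation indices w.  The legs L of outer products are distributed
   between the two factors by the Leibniz rule: those marked by e land on A,
   the others on B. *)
Definition delayed_star (P : coefs) (A B : delayed) : delayed :=
  fun L N y u =>
  \sum_(k < N.+1) (k`!%:R)^-1 *
  \sum_(p < (N - k).+1) \sum_(e : (size L).-tuple bool)
  \sum_(w \in [set: k.-tuple wedge])
    (\prod_(v <- w) wedge_coef P v.1.1.1 v.2.1.1 v.1.2 v.2.2 y)
    * A (map fst w ++ mask e L) p y u
    * B (map snd w ++ mask (map negb e) L) (N - k - p)%N y u.

End JetCalculus.

(** * Global objects *)

Section Global.
Variables (R : realType) (m n : nat) (M : affine_manifold R m).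
Variable pi : affine_bundle M n.

Definition xcoord (t : triv pi) (x : M) : 'rV[R]_m := ccoord (tchart t) x.

Definition timg (t : triv pi) : set 'rV[R]_m := xcoord t @` tdom t.

Definition tvol (t : triv pi) : 'rV[R]_m -> R := vol (tchart t).

Definition local_rep (t : triv pi) (s : M -> total pi) (i : 'I_n) :
    'rV[R]_m -> R :=
  fun y => fib t (s (cpoint (tchart t) y)) ord0 i.

Definition smooth_section (s : M -> total pi) : Prop :=
  (forall x, proj (s x) = x) /\
  forall t i, smooth_base (timg t) (local_rep t s i).

(* Coordinates u^i_s of the infinite jet of s at the point with coordinates y. *)
Definition jet (t : triv pi) (s : M -> total pi) (y : 'rV[R]_m) :
    jidx m n -> R :=
  fun a => mder (@base_partial R m) a.2 (local_rep t s a.1) y.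

(* A density on J^oo(pi), given by its expressions in all adapted coordinates.
   Every finite jet is the jet of a global section, so agreement along sections
   is agreement on J^oo(pi). *)
Record density := Density {
  dens :> triv pi -> jetfun R m n;
  dens_smooth : forall t, smooth_jet (timg t) (dens t);
  dens_compat : forall t t' s x, smooth_section s -> tdom t x -> tdom t' x ->
    dens t (xcoord t x) (jet t s (xcoord t x)) =
    dens t' (xcoord t' x) (jet t' s (xcoord t' x))
}.

(* Linear part of the change of fibre coordinates at x. *)
Definition fibre_lin (t t' : triv pi) (x : M) (v : 'rV[R]_n) : 'rV[R]_n :=
  fib t' (fpoint t x v) - fib t' (fpoint t x 0).

Definition covector (psi : triv pi -> 'rV[R]_m -> 'rV[R]_n) : Prop :=
  (forall t i, smooth_base (timg t) (fun y => psi t y ord0 i)) /\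
  forall t t' x v, tdom t x -> tdom t' x ->
    psi t (xcoord t x) *m v^T = psi t' (xcoord t' x) *m (fibre_lin t t' x v)^T.

(* The vertical vector field obtained from a covector field psi. *)
Definition diffop_row (P : coefs R m n) (psi : 'rV[R]_m -> 'rV[R]_n)
    (y : 'rV[R]_m) : 'rV[R]_n :=
  \row_a diffop P (fun b y _ => psi y ord0 b) a y (fun _ => 0).

Record bivector := Bivector {
  bcoef :> triv pi -> coefs R m n;
  bcoef_smooth : forall t a b l, smooth_base (timg t) (bcoef t a b l);
  bcoef_finite : forall t, exists S : {fset multi m}, forall a b l y,
    timg t y -> l \notin S -> bcoef t a b l y = 0;
  bcoef_compat : forall psi, covector psi ->
    forall t t' x, tdom t x -> tdom t' x ->
      fibre_lin t t' x (diffop_row (bcoef t) (psi t) (xcoord t x)) =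
      diffop_row (bcoef t') (psi t') (xcoord t' x);
  bcoef_skew : forall t, skew_adjoint (timg t) (tvol t) (bcoef t)
}.

Definition poisson (P : bivector) : Prop := forall t,
  let w := bivector_density (P t) in
  horizontally_exact (timg t) (tvol t) (schouten (tvol t) w w).

(* Integral functionals and their products, in each system of adapted
   coordinates. *)
Definition functional := triv pi -> delayed R m n.

Definition integral_of (f : density) : functional := fun t => leaf (f t).

Definition star (P : bivector) (A B : functional) : functional :=
  fun t => delayed_star (P t) (A t) (B t).

(* The coefficient of hbar^k in the density. *)
Definition density_of (A : functional) (k : nat) : triv pi -> jetfun R m n :=
  fun t => A t [::] k.

(* The value at s of the functional with density d; over x the density is
   evaluated in the coordinates [triv_at pi x]. *)
Definition integral_value (d : triv pi -> jetfun R m n) (s : M -> total pi) :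
    R :=
  (\int[volume M]_x
     let t := triv_at pi x in d t (xcoord t x) (jet t s (xcoord t x)))%R.

End Global.

Arguments integral_of {R m n M pi} f.

(* Main.v *)
Require Import Defs.
From mathcomp Require Import all_boot all_order all_algebra.
From mathcomp Require Import all_classical all_reals all_analysis.
From mathcomp Require Import finmap ring.
Import Order.TTheory GRing.Theory Num.Theory.
Import numFieldNormedType.Exports.

Set Implicit Arguments.
Unset Strict Implicit.
Unset Printing Implicit Defensive.

Local Open Scope classical_set_scope.
Local Open Scope ring_scope.

(** Expanding either bracketing gives a sum over directed graphs on the three
    vertices f, g, h.  A graph with a edges between f and g, b edges between f
    and h, and d edges between g and h contributes a product of the edge
    coefficients and of the three densities, each differentiated by the legs of
    the edges that end on it.  Two facts make the contribution depend on the
    graph only.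

    - The total derivatives are delayed, and the edge coefficients do not depend
      on the jet variables, so all partial derivatives act directly on f, g and
      h.  These commute (du_comm: equality of mixed second derivatives of smooth
      functions), and so the value at a vertex depends only on the multiset of
      its legs (vertex_perm), not on which product created them or in which
      order.
    - The Leibniz rule distributes the k edges of the outer product between the
      two vertices of the inner one.  This turns the sum over words of length k
      into a binomial convolution (split_word_sum), whose coefficients change
      the weight 1/(k! (N-k)!) of the iterated exponential into
      1/(a! b! d!).

    Both bracketings then equal the sum over a + b + d = N of 1/(a! b! d!) times
    the sum over graphs with these numbers of edges (bracket_assoc): they only
    enumerate the triples (a, b, d) in different ways (triangle_sum).

    The sums over wedge indices run over an infinite set, and exchanging and
    factoring them needs finite supports.  A density depends on finitely many
    jet coordinates and the bi-vector has finite order, so in a fixed chart at a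
    fixed point only the wedges of one finite set contribute (wedges_out,
    fsbig_tuple).

    Since the densities agree at every point of every chart, the integrands of
    the two functionals are the same function, which gives the statement about
    values. *)

(** * Sums over words and the binomial convolution *)

Section Words.
Variables (R : comPzRingType) (T : finType).

(** The summand takes a sequence rather than a tuple, so that lengths such as
    [k.+1 - p] can be rewritten without casts. *)
Definition word_sum k (F : seq T -> R) : R := \sum_(w : k.-tuple T) F w.

Lemma word_sum0 F : word_sum 0 F = F [::].
Proof.
rewrite /word_sum (big_pred1 [tuple]) // => w.
by apply/esym/eqP; exact: tuple0.
Qed.

Lemma word_sumS k F :
  word_sum k.+1 F = \sum_x word_sum k (fun w => F (x :: w)).
Proof.
rewrite /word_sum pair_bigA /=.
rewrite (reindex (fun z : T * k.-tuple T => [tuple of z.1 :: z.2])) //=.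
exists (fun w => (thead w, [tuple of behead w])) => [[x w] _|w _] /=.
  by rewrite theadE; congr pair; apply: val_inj.
by rewrite [RHS]tuple_eta; apply: val_inj.
Qed.

Lemma eq_word_sum k F G : F =1 G -> word_sum k F = word_sum k G.
Proof. by move=> FG; apply: eq_bigr => w _. Qed.

Lemma eq_size_word_sum k F G :
  (forall w, size w = k -> F w = G w) -> word_sum k F = word_sum k G.
Proof. by move=> FG; apply: eq_bigr => w _; rewrite FG ?size_tuple. Qed.

Lemma word_sumD k F G :
  word_sum k (fun w => F w + G w) = word_sum k F + word_sum k G.
Proof. exact: big_split. Qed.

Lemma word_sumZ k c F : word_sum k (fun w => c * F w) = c * word_sum k F.
Proof. by rewrite /word_sum mulr_sumr. Qed.

Lemma word_sum_sum k (I : finType) (F : I -> seq T -> R) :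
  word_sum k (fun w => \sum_i F i w) = \sum_i word_sum k (F i).
Proof. exact: exchange_big. Qed.

End Words.

Lemma exchange_word_sum (R : comPzRingType) (T U : finType) k l
    (F : seq T -> seq U -> R) :
  word_sum k (fun w => word_sum l (F w)) =
  word_sum l (fun v => word_sum k (F^~ v)).
Proof. exact: exchange_big. Qed.

(** Pascal's rule, in the form needed when a letter is added to a word that is
    split into two subwords. *)
Lemma pascal_sum (R : comPzRingType) (U : nat -> nat -> R) k :
  \sum_(p < k.+2) 'C(k.+1, p)%:R * U p (k.+1 - p)%N =
  \sum_(p < k.+1) 'C(k, p)%:R * (U p.+1 (k - p)%N + U p (k - p).+1).
Proof.
rewrite big_ord_recl /= bin0 subn0.
under eq_bigr => p _ do rewrite /bump /= add1n binS natrD mulrDl subSS.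
rewrite big_split /= big_ord_recr /= bin_small // mul0r addr0 addrA.
under [RHS]eq_bigr => p _ do rewrite mulrDr.
rewrite [RHS]big_split /= addrC; congr (_ + _).
rewrite [RHS]big_ord_recl /= bin0 subn0; congr (_ + _).
by apply: eq_bigr => p _; rewrite /bump /= add1n subnSK.
Qed.

(** Sorting the letters of a word into those marked by [e] and the others gives
    every pair of words of lengths [p] and [k - p] exactly ['C(k, p)] times. *)
Lemma split_word_sum (R : comPzRingType) (T : finType) k
    (F : seq T -> seq T -> R) :
  word_sum k (fun w : seq T => word_sum k (fun e : seq bool =>
    F (mask e w) (mask (map negb e) w))) =
  \sum_(p < k.+1) 'C(k, p)%:R *
    word_sum p (fun v => word_sum (k - p) (fun w => F v w)).
Proof.
(* The first letter goes either to the marked or to the unmarked subword. *)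
elim: k F => [|k IH] F.
  by rewrite big_ord1 !word_sum0 mul1r.
rewrite (pascal_sum (fun p q => word_sum p (fun v => word_sum q (F v)))).
rewrite word_sumS.
transitivity (\sum_x \sum_(p < k.+1) 'C(k, p)%:R *
   (word_sum p (fun v => word_sum (k - p) (F (x :: v))) +
    word_sum p (fun v => word_sum (k - p) (fun w => F v (x :: w))))).
  apply: eq_bigr => x _; under eq_bigr do rewrite mulrDr.
  rewrite big_split /= -!IH -word_sumD; apply: eq_word_sum => w.
  by rewrite word_sumS big_bool.
rewrite exchange_big /=; apply: eq_bigr => p _.
rewrite -mulr_sumr big_split /= word_sumS; congr (_ * (_ + _)).
rewrite -word_sum_sum; apply: eq_word_sum => v.
by rewrite word_sumS.
Qed.

Lemma bin_fact_inv (R : numFieldType) k p : (p <= k)%N ->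
  (k`!%:R)^-1 * 'C(k, p)%:R = (p`!%:R)^-1 * ((k - p)`!%:R)^-1 :> R.
Proof.
move=> pk; have f0 j : j`!%:R != 0 :> R by rewrite pnatr_eq0 -lt0n fact_gt0.
rewrite -(bin_fact pk) !natrM; field.
by rewrite !f0 pnatr_eq0 -lt0n bin_gt0.
Qed.

(** Both sides run over the triples of sum [N]; the outer index [k] fixes the
    first entry of the triple on the left, the last one on the right. *)
Lemma triangle_sum (V : nmodType) N (T : nat -> nat -> nat -> V) :
  \sum_(k < N.+1) \sum_(p < k.+1) T (N - k)%N p (k - p)%N =
  \sum_(k < N.+1) \sum_(p < k.+1) T p (k - p)%N (N - k)%N.
Proof.
rewrite (reindex_inj rev_ord_inj) /=.
transitivity (\sum_(a < N.+1) \sum_(b < (N - a).+1) T a b (N - a - b)%N).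
  by apply: eq_bigr => a _; rewrite subSS subKn // -ltnS.
under [RHS]eq_bigr => k _.
  rewrite (big_ord_widen N.+1 (fun p => T p (k - p)%N (N - k)%N)) ?ltn_ord //.
  over.
rewrite (exchange_big_dep predT) //=; apply: eq_bigr => a _.
transitivity (\sum_(a <= k < N.+1) T a (k - a)%N (N - k)%N).
  rewrite -[X in index_iota X _]add0n big_addn big_mkord subSn; last by rewrite -ltnS.
  by apply: eq_bigr => b _; rewrite addnK subnAC -subnDA addnC.
by rewrite big_geq_mkord.
Qed.

(** * Symmetry of mixed derivatives *)

(** Mean value theorem applied first to the difference of [p] between the two
    horizontal edges of the square of side [e], then in the other direction. *)
Lemma second_difference (R : realType) (p p1 p12 : R -> R -> R) (e : R) :
  (forall s t : R, is_derive s 1 (p ^~ t) (p1 s t)) ->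
  (forall s t : R, is_derive t 1 (p1 s) (p12 s t)) ->
  0 < e -> exists s t, [/\ 0 < s < e, 0 < t < e &
    p e e - p 0 e - (p e 0 - p 0 0) = p12 s t * e * e].
Proof.
move=> dp dp1 e0.
have dq (s : R) : is_derive s 1 (fun s => p s e - p s 0) (p1 s e - p1 s 0).
  by apply: is_deriveB.
have [|s /[1!in_itv]/= hs Es] := MVT e0 (fun s _ => dq s).
  apply: derivable_within_continuous => s _; exact: (@ex_derive _ _ _ _ _ _ _ (dq s)).
have [|t /[1!in_itv]/= ht Et] := MVT e0 (fun t _ => dp1 s t).
  apply: derivable_within_continuous => t _; exact: (@ex_derive _ _ _ _ _ _ _ (dp1 s t)).
exists s, t; split=> //; move: Es Et; rewrite !subr0 => Es Et.
have -> : p e e - p 0 e - (p e 0 - p 0 0) = p e e - p e 0 - (p 0 e - p 0 0) by ring.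
by rewrite Es Et.
Qed.

(** The second difference over a small square is the value of either mixed
    derivative at some point of the square, up to the common factor [e * e]; by
    continuity both values tend to those at the corner. *)
Lemma mixed_derivatives_eq (R : realType) (p p1 p2 p12 p21 : R -> R -> R) :
  (forall s t : R, is_derive s 1 (p ^~ t) (p1 s t)) ->
  (forall s t : R, is_derive t 1 (p s) (p2 s t)) ->
  (forall s t : R, is_derive t 1 (p1 s) (p12 s t)) ->
  (forall s t : R, is_derive s 1 (p2 ^~ t) (p21 s t)) ->
  {for (0, 0), continuous (fun z : R * R => p12 z.1 z.2)} ->
  {for (0, 0), continuous (fun z : R * R => p21 z.1 z.2)} ->
  p12 0 0 = p21 0 0.
Proof.
move=> dp1 dp2 dp12 dp21 c12 c21; apply/eqP; rewrite -subr_eq0 -normr_le0.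
apply/ler_addgt0Pr => d d0; rewrite add0r.
have d2 : 0 < d / 2 by rewrite divr_gt0.
have near0 (q : R -> R -> R) : {for (0, 0), continuous (fun z : R * R => q z.1 z.2)} ->
    exists2 e : R, 0 < e & forall s t, 0 < s < e -> 0 < t < e ->
      `|q 0 0 - q s t| < d / 2.
  move=> /cvgrPdist_lt /(_ _ d2) [[A B] [/= /nbhs_ballP[a a0 aA] /nbhs_ballP[b b0 bB]] AB].
  exists (Num.min a b); first by rewrite lt_min a0.
  move=> s t /andP[s0]; rewrite lt_min => /andP[sa _].
  move=> /andP[t0]; rewrite lt_min => /andP[_ tb].
  apply: (AB (s, t)); split; [apply: aA|apply: bB];
    by rewrite /ball /= sub0r normrN gtr0_norm.
have [a a0 ha] := near0 _ c12; have [b b0 hb] := near0 _ c21.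
have e0 : 0 < Num.min a b by rewrite lt_min a0.
set e := Num.min a b in e0.
have [ea eb] : e <= a /\ e <= b by rewrite /e !ge_min !lexx orbT.
have [s [t [/andP[s0 se] /andP[t0 te] E12]]] := second_difference dp1 dp12 e0.
(* The second difference is symmetric, so the roles of the two variables can
   be exchanged. *)
have [t' [s' [/andP[t0' te'] /andP[s0' se'] E21]]] :=
  second_difference (p := fun t s => p s t) (p1 := fun t s => p2 s t)
    (p12 := fun t s => p21 s t) (fun t s => dp2 s t) (fun t s => dp21 s t) e0.
have E : p12 s t = p21 s' t'.
  apply: (mulIf (lt0r_neq0 e0)); apply: (mulIf (lt0r_neq0 e0)).
  by rewrite -E12 -E21; ring.
have h1 : `|p12 0 0 - p12 s t| < d / 2.
  by apply: ha; rewrite ?s0 ?t0 /= (lt_le_trans _ ea).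
have h2 : `|p21 0 0 - p21 s' t'| < d / 2.
  by apply: hb; rewrite ?s0' ?t0' /= (lt_le_trans _ eb).
rewrite ltW// [d]splitr.
have -> : p12 0 0 - p21 0 0 = (p12 0 0 - p12 s t) - (p21 0 0 - p21 s' t').
  by rewrite E; ring.
exact: le_lt_trans (ler_normB _ _) (ltrD h1 h2).
Qed.

Lemma continuous_ptws (T W : topologicalType) (I : Type) (G : T -> {ptws I -> W})
    (z : T) :
  (forall i, {for z, continuous (fun z => G z i)}) -> {for z, continuous G}.
Proof.
move=> Gi; apply/cvg_sup => i U [N] [[B] oB <-] /= BG BU.
apply: (filterS BU).
exact: (Gi i) B (open_nbhs_nbhs (conj oB BG)).
Qed.

(** * Densities differentiated at a vertex *)

Section Jets.
Variables (R : realType) (m n : nat) (V : set 'rV[R]_m).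
Implicit Types (f g : jetfun R m n) (a b : jidx m n) (L : seq (leg m n)).

(** Smoothness and finite order are only assumed over the open set [V] of base
    points, so identities between jet functions hold over [V] only. *)
Definition agree_on f g := forall y u, V y -> f y u = g y u.

Lemma agree_du a f g : agree_on f g -> agree_on (du a f) (du a g).
Proof.
move=> fg y u Vy; rewrite /du /jet_partial; congr (derive1 _ _).
by apply/funext => t /=; rewrite fg.
Qed.

(** The derivative along the base sees a neighbourhood of the base point, which
    the open set [V] contains. *)
Lemma agree_dx k f g : open V -> agree_on f g -> agree_on (dx k f) (dx k g).
Proof.
move=> oV fg y u Vy; rewrite /dx /jet_partial !derive1E.
apply: near_eq_derive; rewrite /=.
have : continuous (fun t : R => y + t *: (delta_mx ord0 k : 'rV[R]_m)).
  move=> t; apply: cvgD; first exact: cvg_cst.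
  exact: (@scalel_continuous R _ (delta_mx ord0 k : 'rV[R]_m)).
move=> /(_ 0) /(_ V); rewrite scale0r addr0 => /(_ (open_nbhs_nbhs (conj oV Vy))) N.
have {}N : \forall t \near (0 : R), V (y + t *: delta_mx ord0 k) by exact: N.
by near=> t; rewrite fg //; near: t.
Unshelve. all: by end_near.
Qed.

Lemma agree_tD k f g : open V -> agree_on f g -> agree_on (tD k f) (tD k g).
Proof.
move=> oV fg y u Vy; rewrite /tD (agree_dx k oV fg) //; congr (_ + _).
by apply: eq_fsbigr => a _; rewrite (agree_du a fg).
Qed.

Lemma agree_tDm s f g : open V -> agree_on f g -> agree_on (tDm s f) (tDm s g).
Proof.
move=> oV fg; rewrite /tDm /mder; elim: (enum 'I_m) => //= k ks IH.
by elim: (s k) => //= j; exact: agree_tD.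
Qed.

Lemma agree_tDneg s f g :
  open V -> agree_on f g -> agree_on (tDneg s f) (tDneg s g).
Proof. by move=> oV fg y u Vy; rewrite /tDneg (agree_tDm s oV fg). Qed.

Lemma tD0 k : tD k (fun _ _ => 0) = (fun _ _ => 0) :> jetfun R m n.
Proof.
apply/funext => y; apply/funext => u; rewrite /tD fsbig1 ?addr0.
  by rewrite /dx /jet_partial derive1_cst.
by move=> a _; rewrite /du /jet_partial derive1_cst mulr0.
Qed.

Lemma tDm0 s : tDm s (fun _ _ => 0) = (fun _ _ => 0) :> jetfun R m n.
Proof.
rewrite /tDm /mder; elim: (enum 'I_m) => //= k ks ->.
by elim: (s k) => //= j ->; exact: tD0.
Qed.

Definition depends_on (S : {fset jidx m n}) f := forall y u u', V y ->
  (forall a, a \in S -> u a = u' a) -> f y u = f y u'.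

Lemma depends_on_du S a f : depends_on S f -> depends_on S (du a f).
Proof.
move=> Sf y u u' Vy uu; rewrite /du /jet_partial; congr (derive1 _ _).
by apply/funext => t /=; apply: Sf => // b bS; rewrite uu.
Qed.

Lemma du_eq0 S a f : depends_on S f -> a \notin S ->
  agree_on (du a f) (fun _ _ => 0).
Proof.
move=> Sf aS y u Vy; rewrite /du /jet_partial /=.
rewrite (_ : (fun t => _) = cst (f y u)) ?derive1_cst //.
apply/funext => t; apply: Sf => // b bS.
by rewrite (_ : b == a = false) ?mulr0 ?addr0 //; apply: contraNF aS => /eqP<-.
Qed.

Definition leg_du f L : jetfun R m n := foldr (fun l g => du l.1 g) f L.

Lemma leg_du_eq0 S f L l : depends_on S f -> l \in L -> l.1 \notin S ->
  agree_on (leg_du f L) (fun _ _ => 0).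
Proof.
move=> Sf + lS; elim: L => //= l' L IH; rewrite inE => /orP[/eqP <-|lL].
  apply: du_eq0 lS; elim: L {IH} => //= l2 L; exact: depends_on_du.
move=> y u Vy; rewrite (agree_du _ (IH lL)) //.
by rewrite /du /jet_partial derive1_cst.
Qed.

(** A derivative at 0 along the line through [u + s e_a] is a derivative at [s]
    along the line through [u]. *)
Lemma is_derive_du f cs : smooth_jet V f ->
  let g := foldr (@jet_partial R m n) f cs in
  forall a y u (s : R), V y ->
   is_derive s 1 (fun t => g y (fun b => u b + t * (b == a)%:R))
    (du a g y (fun b => u b + s * (b == a)%:R)).
Proof.
move=> [_ sf] g a y u s Vy.
have [_ /(_ (inr a)) /= D] := sf cs y (fun b => u b + s * (b == a)%:R) Vy.
pose q := fun t => g y (fun b => u b + t * (b == a)%:R).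
have E t : g y (fun b => (u b + s * (b == a)%:R) + t * (b == a)%:R) = q (s + t).
  by congr (g y _); apply/funext => b; rewrite mulrDl addrA.
have qE : (fun t => g y (fun b => (u b + s * (b == a)%:R) + t * (b == a)%:R)) =
    fun t => q (t *: 1 + s).
  by apply/funext => t; rewrite E [t *: 1]mulr1 addrC.
suff [dq vq] : derivable q s 1 /\
  'D_1 q s = du a g y (fun b => u b + s * (b == a)%:R) by exact: DeriveDef.
split; first by apply/derivable1P; rewrite -qE.
rewrite /du /jet_partial /= qE derive1E /derive.
apply: (congr1 (fun F : R -> R => lim (F @ 0^'))); apply/funext => t /=.
by rewrite addr0 scale0r add0r [(t *: 1) *: 1]mulr1.
Qed.

Lemma continuous_plane f y (u : jidx m n -> R) a b :
  {for (y, u), continuous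
     (fun p : 'rV[R]_m * {ptws jidx m n -> R} => f p.1 p.2)} ->
  {for (0, 0), continuous (fun z : R * R =>
     f y (fun c => u c + z.1 * (c == a)%:R + z.2 * (c == b)%:R))}.
Proof.
move=> cf.
pose v (z : R * R) : {ptws jidx m n -> R} :=
  fun c => u c + z.1 * (c == a)%:R + z.2 * (c == b)%:R.
pose w z := (y, v z).
suff cw : {for (0, 0), continuous w}.
  apply: (@continuous_comp _ _ _ w (fun p => f p.1 p.2)) => //.
  rewrite /w /= (_ : v _ = u) //.
  by apply/funext => c; rewrite /v !mul0r !addr0.
apply: (@cvg_pair _ _ _ _ (nbhs y) (nbhs (v (0, 0))) _ _ _ (cst y) v).
  exact: cvg_cst.
apply: continuous_ptws => c.
apply: cvgD; last by apply: cvgMl; exact: cvg_snd.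
by apply: cvgD; [exact: cvg_cst|apply: cvgMl; exact: cvg_fst].
Qed.

(** Restricted to the plane through [u] spanned by the directions [a] and [b],
    this is the symmetry of mixed derivatives of a function of two variables. *)
Lemma du_comm f cs a b : smooth_jet V f ->
  let g := foldr (@jet_partial R m n) f cs in
  agree_on (du a (du b g)) (du b (du a g)).
Proof.
move=> sf g y u Vy.
pose w (s t : R) : jidx m n -> R :=
  fun c => u c + s * (c == b)%:R + t * (c == a)%:R.
have wC s t : w s t = fun c => u c + t * (c == a)%:R + s * (c == b)%:R.
  by apply/funext => c; rewrite /w addrAC.
have w0 : w 0 0 = u by apply/funext => c; rewrite /w !mul0r !addr0.
rewrite -w0.
apply: (@mixed_derivatives_eq R (fun s t => g y (w s t))
  (fun s t => du b g y (w s t)) (fun s t => du a g y (w s t))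
  (fun s t => du a (du b g) y (w s t)) (fun s t => du b (du a g) y (w s t))).
- move=> s t; rewrite wC.
  under eq_fun do rewrite wC.
  exact: (@is_derive_du f cs).
- by move=> s t; exact: (@is_derive_du f cs).
- by move=> s t; exact: (@is_derive_du f (inr b :: cs)).
- move=> s t; rewrite wC.
  under eq_fun do rewrite wC.
  exact: (@is_derive_du f (inr a :: cs)).
- exact: (@continuous_plane (du a (du b g)) y u b a (sf.2 (inr a :: inr b :: cs) y u Vy).1).
- exact: (@continuous_plane (du b (du a g)) y u b a (sf.2 (inr b :: inr a :: cs) y u Vy).1).
Qed.

(** The legs at a vertex produce an iterated jet derivative, so the smoothness of
    the density applies at each stage. *)
Lemma leg_duE f L :
  leg_du f L = foldr (@jet_partial R m n) f [seq inr l.1 | l <- L].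
Proof. by rewrite /leg_du; elim: L => //= l L ->. Qed.

Lemma leg_du_bubble f L1 L2 l : smooth_jet V f ->
  agree_on (leg_du f (L1 ++ l :: L2)) (leg_du f (l :: L1 ++ L2)).
Proof.
move=> sf; elim: L1 => [//|l' L1 IH] y u Vy.
transitivity (du l'.1 (leg_du f (l :: L1 ++ L2)) y u).
  exact: (agree_du _ IH).
have C := @du_comm f [seq inr l.1 | l <- L1 ++ L2] l'.1 l.1 sf y u Vy.
by rewrite -leg_duE in C; exact: C.
Qed.

Lemma leg_du_perm f L L' : smooth_jet V f -> perm_eq L L' ->
  agree_on (leg_du f L) (leg_du f L').
Proof.
move=> sf; elim: L L' => [|l L IH] L' LL'.
  by move: LL'; rewrite perm_sym => /perm_nilP ->.
have /splitPr lL' : l \in L' by rewrite -(perm_mem LL') mem_head.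
case: lL' LL' => L1 L2; rewrite perm_sym perm_catC /= perm_cons perm_catC perm_sym.
move=> /IH LL' y u Vy; rewrite leg_du_bubble //=; exact: agree_du.
Qed.

(** The multi-indices of the delayed total derivatives only enter through their
    sums, and the partial derivatives commute. *)
Lemma vertex_perm f L L' : open V -> smooth_jet V f -> perm_eq L L' ->
  agree_on (vertex f L) (vertex f L').
Proof.
move=> oV sf LL'; rewrite /vertex !(perm_big _ LL') /=.
by apply/agree_tDneg/agree_tDm/leg_du_perm.
Qed.

(** A derivative along a coordinate on which the density does not depend kills
    it, wherever it stands in the list of legs. *)
Lemma vertex_eq0 S f L l : open V -> depends_on S f -> l \in L -> l.1 \notin S ->
  agree_on (vertex f L) (fun _ _ => 0).
Proof.
move=> oV Sf lL lS y u Vy; rewrite /vertex.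
have fL := leg_du_eq0 Sf lL lS.
by rewrite (agree_tDneg _ oV (agree_tDm _ oV fL)) // tDm0 /tDneg tDm0 mulr0.
Qed.

End Jets.

(** The coordinate map of a chart is a homeomorphism onto an open set. *)
Lemma open_timg (R : realType) (m n : nat) (M : affine_manifold R m)
  (pi : affine_bundle M n) (t : triv pi) : open (timg t).
Proof.
rewrite openE => _ [x tx <-]; rewrite /interior.
have dx := tdom_sub tx; have iy := ccoordP dx.
have oc := @cimg_open _ _ M (tchart t).
have := @cpoint_cont _ _ M (tchart t); rewrite continuous_open_subspace //.
move=> /(_ _ (mem_set iy)) /(_ (tdom t)); rewrite ccoordK //.
move=> /(_ (open_nbhs_nbhs (conj (@tdom_open _ _ _ _ pi t) tx))) N.
have N' : \forall y \near xcoord t x, tdom t (Defs.cpoint (tchart t) y) by exact: N.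
have I : \forall y \near xcoord t x, cimg (tchart t) y.
  exact: open_nbhs_nbhs (conj (@cimg_open _ _ _ _) iy).
near=> y; exists (Defs.cpoint (tchart t) y); first by near: y.
by rewrite /xcoord cpointK //; near: y.
Unshelve. all: by end_near. Qed.

(** * Graphs on three vertices *)

Lemma perm_mask_negb (T : eqType) (e : seq bool) (w : seq T) :
  size e = size w -> perm_eq w (mask e w ++ mask (map negb e) w).
Proof.
elim: w e => [|x w IH] [|b e] //= [/IH H].
by case: b => /=; rewrite ?perm_cons // perm_sym perm_catC /= perm_cons perm_catC perm_sym.
Qed.

Section ThreeVertices.
Variables (R : numFieldType) (E : finType) (X : eqType).
(* An edge has two ends: [src] is the leg at the earlier of the vertices that it
   joins, in the order F, G, H, and [tgt] the leg at the later one. *)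
Variables (src tgt : E -> X) (c : E -> R) (F G H : seq X -> R).
Hypothesis Fperm : forall L L', perm_eq L L' -> F L = F L'.
Hypothesis Gperm : forall L L', perm_eq L L' -> G L = G L'.
Hypothesis Hperm : forall L L', perm_eq L L' -> H L = H L'.

Definition weight (w : seq E) : R := \prod_(x <- w) c x.

(** The words [x], [y], [z] list the edges from F to G, from F to H, and from G
    to H. *)
Definition graph (x y z : seq E) : R :=
  weight x * weight y * weight z * F (map src x ++ map src y) *
  G (map tgt x ++ map src z) * H (map tgt y ++ map tgt z).

Definition graph_sum a b d : R :=
  word_sum a (fun x => word_sum b (fun y => word_sum d (graph x y))).

Lemma weight_mask e w : size e = size w ->
  weight w = weight (mask e w) * weight (mask (map negb e) w).
Proof. by move=> /perm_mask_negb ew; rewrite /weight (perm_big _ ew) big_cat. Qed.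

(** Order [N] of the bracketing (F * G) * H: the outer product contributes the
    [k] edges [w] ending on H, and [e] marks those that start on F. *)
Definition bracket_left N : R :=
  \sum_(k < N.+1) (k`!%:R)^-1 * word_sum k (fun w =>
    weight w *
    (((N - k)`!%:R)^-1 * word_sum k (fun e => word_sum (N - k) (fun v =>
      weight v * F (map src v ++ mask e (map src w)) *
      G (map tgt v ++ mask (map negb e) (map src w))))) *
    H (map tgt w)).

(** Order [N] of the bracketing F * (G * H): the [k] edges [w] start on F, and
    [e] marks those that end on G. *)
Definition bracket_right N : R :=
  \sum_(k < N.+1) (k`!%:R)^-1 * word_sum k (fun w =>
    weight w * F (map src w) *
    (((N - k)`!%:R)^-1 * word_sum k (fun e => word_sum (N - k) (fun v =>
      weight v * G (map src v ++ mask e (map tgt w)) *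
      H (map tgt v ++ mask (map negb e) (map tgt w)))))).

Definition graph_term a b d : R :=
  (a`!%:R)^-1 * (b`!%:R)^-1 * (d`!%:R)^-1 * graph_sum a b d.

(** The weight of an iterated product becomes the symmetric weight
    1/(a! b! d!). *)
Lemma split_graph_sum N k (K : seq E -> seq E -> seq E -> R) : (k <= N)%N ->
  (k`!%:R)^-1 * (((N - k)`!%:R)^-1 * word_sum k (fun w => word_sum k (fun e =>
    word_sum (N - k) (K (mask e w) (mask (map negb e) w))))) =
  \sum_(p < k.+1) (p`!%:R)^-1 * ((k - p)`!%:R)^-1 * ((N - k)`!%:R)^-1 *
    word_sum p (fun v => word_sum (k - p) (fun w => word_sum (N - k) (K v w))).
Proof.
move=> kN; rewrite (split_word_sum k (fun v w => word_sum (N - k) (K v w))).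
rewrite !mulr_sumr; apply: eq_bigr => p _; rewrite -bin_fact_inv ?leq_ord //.
by ring.
Qed.

Lemma bracket_leftE N : bracket_left N =
  \sum_(k < N.+1) \sum_(p < k.+1) graph_term (N - k) p (k - p).
Proof.
apply: eq_bigr => k _.
transitivity ((k`!%:R)^-1 * (((N - k)`!%:R)^-1 * word_sum k (fun w => word_sum k (fun e =>
    word_sum (N - k) (fun v => graph v (mask e w) (mask (map negb e) w)))))).
  congr (_ * _); rewrite -word_sumZ; apply: eq_size_word_sum => w wk.
  rewrite mulrCA -mulrA; congr (_ * _); rewrite mulrAC -word_sumZ.
  apply: eq_size_word_sum => e ek; rewrite -word_sumZ.
  apply: eq_word_sum => v; rewrite /graph.
  have ew : size e = size w by rewrite ek wk.
  have -> : H (map tgt w) =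
      H (map tgt (mask e w) ++ map tgt (mask (map negb e) w)).
    by rewrite -map_cat; apply/Hperm/perm_map/perm_mask_negb.
  by rewrite (weight_mask ew) !map_mask; ring.
rewrite (split_graph_sum (fun y z v => graph v y z)) ?leq_ord //.
apply: eq_bigr => p _; rewrite /graph_term /graph_sum; congr (_ * _).
  by ring.
rewrite [RHS]exchange_word_sum; apply: eq_word_sum => y; exact: exchange_word_sum.
Qed.

Lemma bracket_rightE N : bracket_right N =
  \sum_(k < N.+1) \sum_(p < k.+1) graph_term p (k - p) (N - k).
Proof.
apply: eq_bigr => k _.
transitivity ((k`!%:R)^-1 * (((N - k)`!%:R)^-1 * word_sum k (fun w => word_sum k (fun e =>
    word_sum (N - k) (graph (mask e w) (mask (map negb e) w)))))).
  congr (_ * _); rewrite -word_sumZ; apply: eq_size_word_sum => w wk.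
  rewrite mulrCA; congr (_ * _); rewrite -word_sumZ.
  apply: eq_size_word_sum => e ek; rewrite -word_sumZ.
  apply: eq_word_sum => v; rewrite /graph.
  have ew : size e = size w by rewrite ek wk.
  have -> : F (map src w) =
      F (map src (mask e w) ++ map src (mask (map negb e) w)).
    by rewrite -map_cat; apply/Fperm/perm_map/perm_mask_negb.
  rewrite (Gperm (permEl (perm_catC (map src v) _))).
  rewrite (Hperm (permEl (perm_catC (map tgt v) _))).
  by rewrite (weight_mask ew) !map_mask; ring.
by rewrite (split_graph_sum graph) ?leq_ord.
Qed.

Lemma bracket_assoc N : bracket_left N = bracket_right N.
Proof. by rewrite bracket_leftE bracket_rightE triangle_sum. Qed.

End ThreeVertices.

(** Words with a letter outside [W] do not contribute, and the others are the
    words over the finite type [W]. *)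
Lemma fsbig_tuple (R : comPzRingType) (T : choiceType) (W : {fset T}) k
    (F : seq T -> R) :
  (forall w x, x \in w -> x \notin W -> F w = 0) ->
  \sum_(w \in [set: k.-tuple T]) F w =
  word_sum k (fun w : seq W => F (map val w)).
Proof.
move=> F0; pose r := [seq map_tuple val t | t <- enum {: k.-tuple W}].
rewrite (fsbigE r) //; first last.
- move=> w _ wr; have [/allP wW|/allPn [x xw xW]] := boolP (all (mem W) w); last exact: F0 xW.
  case/negP: wr; apply/mapP.
  exists (mktuple (fun i => [` wW _ (mem_tnth i w)]%fset)); first by rewrite mem_enum.
  by apply: eq_from_tnth => i; rewrite tnth_map tnth_mktuple.
- by rewrite map_inj_uniq ?enum_uniq // => w v /(congr1 val) /(inj_map val_inj) /val_inj.
rewrite big_map big_enum_cond /= /word_sum.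
by apply: eq_bigl => w; rewrite in_setT.
Qed.

(** * From delayed products to graph sums *)

Section DelayedProducts.
Variables (R : realType) (m n : nat) (P : coefs R m n).
Implicit Types (f g h : jetfun R m n) (A : delayed R m n).

Definition edge_coef (y : 'rV[R]_m) (v : wedge m n) : R :=
  wedge_coef P v.1.1.1 v.2.1.1 v.1.2 v.2.2 y.

(** Densities have order 0 in hbar, so at order [N] only the term with [N]
    wedges survives. *)
Lemma delayed_star_leaves f g L N y u :
  delayed_star P (leaf f) (leaf g) L N y u =
  (N`!%:R)^-1 * \sum_(e : (size L).-tuple bool)
    \sum_(w \in [set: N.-tuple (wedge m n)])
      (\prod_(v <- w) edge_coef y v) * vertex f (map fst w ++ mask e L) y u
      * vertex g (map snd w ++ mask (map negb e) L) y u.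
Proof.
rewrite /delayed_star big_ord_recr /= big1 ?add0r => [|k _].
  by rewrite subnn big_ord1.
rewrite big1 ?mulr0 // => p _; rewrite big1 // => e _; rewrite fsbig1 // => w _.
have [-> /=|p0] := posnP p; last by case: (nat_of_ord p) p0 => //= q _; rewrite mulr0 mul0r.
rewrite subn0; have : (0 < N - k)%N by rewrite subn_gt0.
by case: (N - k)%N => //= q _; rewrite mulr0.
Qed.

(** No legs from outside are to be distributed, and the order in hbar left over
    by the [k] wedges is that of the composite factor. *)
Lemma delayed_star_leafr A h N y u :
  delayed_star P A (leaf h) [::] N y u =
  \sum_(k < N.+1) (k`!%:R)^-1 * \sum_(w \in [set: k.-tuple (wedge m n)])
    (\prod_(v <- w) edge_coef y v) * A (map fst w) (N - k)%N y u
    * vertex h (map snd w) y u.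
Proof.
rewrite /delayed_star; apply: eq_bigr => k _; congr (_ * _).
rewrite big_ord_recr /= big1 ?add0r => [|p _].
  rewrite (big_pred1 [tuple]) => [|e]; last by apply/esym/eqP; exact: tuple0.
  by apply: eq_fsbigr => w _; rewrite !cats0 subnn.
rewrite big1 // => e _; rewrite fsbig1 // => w _.
have : (0 < N - k - p)%N by rewrite subn_gt0.
by case: (N - k - p)%N => //= q _; rewrite mulr0.
Qed.

Lemma delayed_star_leafl f A N y u :
  delayed_star P (leaf f) A [::] N y u =
  \sum_(k < N.+1) (k`!%:R)^-1 * \sum_(w \in [set: k.-tuple (wedge m n)])
    (\prod_(v <- w) edge_coef y v) * vertex f (map fst w) y u
    * A (map snd w) (N - k)%N y u.
Proof.
rewrite /delayed_star; apply: eq_bigr => k _; congr (_ * _).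
rewrite big_ord_recl /= addrC big1 ?add0r => [|p _].
  rewrite (big_pred1 [tuple]) => [|e]; last by apply/esym/eqP; exact: tuple0.
  by apply: eq_fsbigr => w _; rewrite !cats0 subn0.
rewrite big1 // => e _; rewrite fsbig1 // => w _.
by rewrite mulr0 mul0r.
Qed.

Section Support.
Variables (V : set 'rV[R]_m) (S : {fset jidx m n}) (T : {fset multi m}).
Variables (y : 'rV[R]_m) (u : jidx m n -> R).
Hypotheses (oV : open V) (Vy : V y).
(* [T] bounds the order of the bi-vector over [y]. *)
Hypothesis PT : forall a b l, l \notin T -> P a b l y = 0.

(** Each of the two multi-indices of a wedge with nonzero coefficient is either
    empty or an index of the bi-vector, hence the added 0. *)
Definition wedges : {fset wedge m n} :=
  ((S `*` (0 |` T)) `*` (S `*` (0 |` T)))%fset.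

Lemma wedges_out x : x \notin wedges ->
  [\/ x.1.1 \notin S, x.2.1 \notin S | edge_coef y x = 0].
Proof.
case: x => [[a t] [b z]]; rewrite !inE /= => xW.
have [aS|aS] := boolP (a \in S); last by constructor 1.
have [bS|bS] := boolP (b \in S); last by constructor 2.
constructor 3; rewrite /edge_coef /wedge_coef /=; move: xW; rewrite aS bS /= !negb_and !negb_or.
by case/orP => /andP[/negPf ->] /PT E; rewrite E ?mul0r ?mulr0 ?subr0 ?sub0r ?oppr0 ?mulr0.
Qed.

Lemma prod_edge_coef_eq0 (w : seq (wedge m n)) x :
  x \in w -> edge_coef y x = 0 -> \prod_(v <- w) edge_coef y v = 0.
Proof. by move=> xw x0; rewrite (big_rem x) //= x0 mul0r. Qed.

Lemma delayed_star_leaves_fin f g L N :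
  depends_on V S f -> depends_on V S g ->
  delayed_star P (leaf f) (leaf g) L N y u =
  (N`!%:R)^-1 * word_sum (size L) (fun e => word_sum N (fun w : seq wedges =>
    (\prod_(v <- map val w) edge_coef y v)
    * vertex f (map fst (map val w) ++ mask e L) y u
    * vertex g (map snd (map val w) ++ mask (map negb e) L) y u)).
Proof.
move=> Sf Sg; rewrite delayed_star_leaves; congr (_ * _); apply: eq_bigr => e _.
rewrite (@fsbig_tuple _ _ wedges N (fun w => (\prod_(v <- w) edge_coef y v)
  * vertex f (map fst w ++ mask e L) y u
  * vertex g (map snd w ++ mask (map negb e) L) y u)) // => w x xw /wedges_out[xS|xS|x0].
- rewrite (vertex_eq0 (S := S) (l := x.1) oV Sf) ?mulr0 ?mul0r //.
  by rewrite mem_cat map_f.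
- rewrite (vertex_eq0 (S := S) (l := x.2) oV Sg) ?mulr0 ?mul0r //.
  by rewrite mem_cat map_f.
- by rewrite (prod_edge_coef_eq0 xw x0) !mul0r.
Qed.

(** By the Leibniz rule every outer leg lands on one of the two densities, and
    both are killed by it. *)
Lemma delayed_star_leaves_eq0 f g L N l :
  depends_on V S f -> depends_on V S g -> l \in L -> l.1 \notin S ->
  delayed_star P (leaf f) (leaf g) L N y u = 0.
Proof.
move=> Sf Sg lL lS; rewrite delayed_star_leaves big1 ?mulr0 // => e _.
rewrite fsbig1 // => w _.
have : l \in mask e L ++ mask (map negb e) L.
  by rewrite -(perm_mem (perm_mask_negb _)) // size_tuple.
rewrite mem_cat => /orP[le|le].
  by rewrite (vertex_eq0 oV Sf _ lS) ?mulr0 ?mul0r // mem_cat le orbT.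
by rewrite (vertex_eq0 oV Sg _ lS) ?mulr0 ?mul0r // mem_cat le orbT.
Qed.

Variables f g h : jetfun R m n.
Hypotheses (sf : smooth_jet V f) (sg : smooth_jet V g) (sh : smooth_jet V h).
Hypotheses (Sf : depends_on V S f) (Sg : depends_on V S g)
  (Sh : depends_on V S h).

(* The graph sums are taken over the finite type of relevant wedges. *)
Let src (x : wedges) := (val x).1.
Let tgt (x : wedges) := (val x).2.
Let wt (x : wedges) := edge_coef y (val x).

Lemma delayed_star_bracket_left N :
  delayed_star P (delayed_star P (leaf f) (leaf g)) (leaf h) [::] N y u =
  bracket_left src tgt wt (fun L => vertex f L y u) (fun L => vertex g L y u)
    (fun L => vertex h L y u) N.
Proof.
rewrite delayed_star_leafr; apply: eq_bigr => k _; congr (_ * _).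
rewrite (@fsbig_tuple _ _ wedges k (fun w => (\prod_(v <- w) edge_coef y v)
  * delayed_star P (leaf f) (leaf g) (map fst w) (N - k)%N y u
  * vertex h (map snd w) y u)); last first.
  move=> w x xw /wedges_out[xS|xS|x0].
  - by rewrite (@delayed_star_leaves_eq0 _ _ _ _ x.1) ?mulr0 ?mul0r ?map_f.
  - by rewrite (vertex_eq0 (S := S) (l := x.2) oV Sh) ?mulr0 ?mul0r ?map_f.
  - by rewrite (prod_edge_coef_eq0 xw x0) !mul0r.
apply: eq_size_word_sum => w wk.
rewrite delayed_star_leaves_fin // !size_map wk /weight big_map -!map_comp.
congr (_ * (_ * _) * _); apply: eq_word_sum => e; apply: eq_word_sum => v.
by rewrite /weight big_map -!map_comp.
Qed.

Lemma delayed_star_bracket_right N :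
  delayed_star P (leaf f) (delayed_star P (leaf g) (leaf h)) [::] N y u =
  bracket_right src tgt wt (fun L => vertex f L y u) (fun L => vertex g L y u)
    (fun L => vertex h L y u) N.
Proof.
rewrite delayed_star_leafl; apply: eq_bigr => k _; congr (_ * _).
rewrite (@fsbig_tuple _ _ wedges k (fun w => (\prod_(v <- w) edge_coef y v)
  * vertex f (map fst w) y u
  * delayed_star P (leaf g) (leaf h) (map snd w) (N - k)%N y u)); last first.
  move=> w x xw /wedges_out[xS|xS|x0].
  - by rewrite (vertex_eq0 (S := S) (l := x.1) oV Sf) ?mulr0 ?mul0r ?map_f.
  - by rewrite (@delayed_star_leaves_eq0 _ _ _ _ x.2) ?mulr0 ?mul0r ?map_f.
  - by rewrite (prod_edge_coef_eq0 xw x0) !mul0r.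
apply: eq_size_word_sum => w wk.
rewrite delayed_star_leaves_fin // !size_map wk /weight big_map -!map_comp.
congr (_ * (_ * _)); apply: eq_word_sum => e; apply: eq_word_sum => v.
by rewrite /weight big_map -!map_comp.
Qed.

Lemma delayed_star_assoc N :
  delayed_star P (delayed_star P (leaf f) (leaf g)) (leaf h) [::] N y u =
  delayed_star P (leaf f) (delayed_star P (leaf g) (leaf h)) [::] N y u.
Proof.
rewrite delayed_star_bracket_left delayed_star_bracket_right.
by apply: bracket_assoc => L L' LL'; apply: (vertex_perm oV).
Qed.

End Support.
End DelayedProducts.

Lemma depends_onW (R : realType) (m n : nat) (V : set 'rV[R]_m)
    (S S' : {fset jidx m n}) (f : jetfun R m n) :
  (S `<=` S')%fset -> depends_on V S f -> depends_on V S' f.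
Proof. by move=> /fsubsetP SS Sf y u u' Vy uu; apply: Sf => // a /SS /uu. Qed.

Theorem mainTheorem1 (R : realType) (m n : nat) (M : affine_manifold R m)
    (pi : affine_bundle M n) (P : bivector pi) (hP : poisson P)
    (f g h : density pi) :
  let F := integral_of f in
  let G := integral_of g in
  let H := integral_of h in
  let lhs := star P (star P F G) H in
  let rhs := star P F (star P G H) in
  forall k : nat,
  let associator : triv pi -> jetfun R m n :=
    fun t y u => density_of lhs k t y u - density_of rhs k t y u in
  (forall s, smooth_section s ->
     integral_value (density_of lhs k) s - integral_value (density_of rhs k) s
     = integral_value associator s) /\
  (forall t y u, timg t y -> associator t y u = 0).
Proof.
move=> F G H lhs rhs k.
have assoc t y u : timg t y -> density_of lhs k t y u = density_of rhs k t y u.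
  move=> ty.
  have [[Sf Hf] _] := dens_smooth f t.
  have [[Sg Hg] _] := dens_smooth g t.
  have [[Sh Hh] _] := dens_smooth h t.
  have [T HT] := bcoef_finite P t.
  apply: (delayed_star_assoc (V := timg t) (S := (Sf `|` Sg `|` Sh)%fset) (T := T)) => //.
  - exact: open_timg.
  - by move=> a b l; exact: HT.
  - exact: dens_smooth.
  - exact: dens_smooth.
  - exact: dens_smooth.
  - by apply: (depends_onW _ Hf); rewrite -fsetUA fsubsetUl.
  - by apply: (depends_onW _ Hg); rewrite fsetUAC fsubsetUr.
  - by apply: (depends_onW _ Hh); rewrite fsubsetUr.
move=> associator; split=> [s _|t y u ty]; last by rewrite /associator assoc ?subrr.
have img x : timg (triv_at pi x) (xcoord (triv_at pi x) x).
  by exists x => //; exact: triv_atP.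
have -> : integral_value (density_of lhs k) s = integral_value (density_of rhs k) s.
  by rewrite /integral_value; congr (Rintegral _ _ _); apply/funext => x; exact: assoc.
rewrite subrr /integral_value.
rewrite (_ : (fun x => _) = cst 0) ?Rintegral_cst ?mul0r //.
by apply/funext => x; rewrite /associator assoc ?subrr.
Qed.
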